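(* Let $I_m\succ T\succ0$ and let $F(s)$ be an arbitrary $m\times m$-valued canonical $\mathcal{HP}_T$ function. Then it can be written as $$F(s)=T^{-\frac12}\left(\prod_{j=1}^k\left(I_m-\frac{2}{1+\psi_j(s)}\,v_jv_j^*\right)\right)(T^{-1}-T)^{\frac12}+T^{-1}$$ for some $k$, where $v_j\in\mathbb{C}^m$, $v_j^*v_j=1$, and the $\psi_j(s)$ are scalar $\mathcal{PO}$ functions.
   Context: $\mathbb{C}_R$ is the open right half plane, $\succ$ the positive definite order, $^*$ the conjugate transpose. An $m\times m$-valued rational function $F$ is a canonical $\mathcal{HP}_T$ function if $F(s)+F(s)^*-\big(T+F(s)^*TF(s)\big)$ is positive semidefinite for all $s\in\mathbb{C}_R$ and is $0$ for all $s\in i\mathbb{R}$. A rational function $\psi$ is in $\mathcal{P}$ if $\psi(s)+\psi(s)^*$ is positive semidefinite for all $s\in\mathbb{C}_R$, and in $\mathcal{PO}$ if $\psi\in\mathcal{P}$ and $\psi(s)=-\big(\psi(-s^* )\big)^*$. *)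

(* Defs.v *)
From HB Require Import structures.
From mathcomp Require Import all_boot all_order all_algebra fraction.
From mathcomp Require Import sesquilinear spectral.
From mathcomp Require Import complex reals.

Set Implicit Arguments.
Unset Strict Implicit.
Unset Printing Implicit Defensive.

Import Order.TTheory GRing.Theory Num.Theory.
Local Open Scope ring_scope.
Local Open Scope sesquilinear_scope.

Section Matrices.
Variable C : numClosedFieldType.

(* In C, [0 <= z] and [0 < z] entail that z is real. *)
Definition posdefmx n (A : 'M[C]_n) : Prop :=
  A ^t* = A /\ forall x : 'cV[C]_n, x != 0 -> 0 < (x ^t* *m A *m x) 0 0.

Definition possemidefmx n (A : 'M[C]_n) : Prop :=
  A ^t* = A /\ forall x : 'cV[C]_n, 0 <= (x ^t* *m A *m x) 0 0.

(* The principal square root: for A Hermitian positive semidefinite it is the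
   positive semidefinite matrix whose square is A
   (cf. [sqrtmx_psd], [sqr_sqrtmx] and [sqrtmx_pd]). *)
Definition sqrtmx n (A : 'M[C]_n) : 'M[C]_n :=
  (spectralmx A)^t* *m diag_mx (map_mx sqrtC (spectral_diag A)) *m spectralmx A.

End Matrices.

Notation ratfun C := {fraction {poly C}}.

Section RationalFunctions.
Variable C : numClosedFieldType.
Implicit Types (f : ratfun C) (s : C).

(* Numerator and denominator in lowest terms (up to a common constant). *)
Definition rnum f : {poly C} :=
  \n_(repr f) %/ gcdp \n_(repr f) \d_(repr f).
Definition rden f : {poly C} :=
  \d_(repr f) %/ gcdp \n_(repr f) \d_(repr f).

Definition pole f s : bool := root (rden f) s.

(* The value f(s); meaningful only when s is not a pole of f. *)
Definition reval f s : C := (rnum f).[s] / (rden f).[s].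

Definition rconst (c : C) : ratfun C := FracField.tofrac c%:P.

Definition mxpole m n (F : 'M[ratfun C]_(m, n)) s : bool :=
  [exists i, exists j, pole (F i j) s].

Definition mxreval m n (F : 'M[ratfun C]_(m, n)) s : 'M[C]_(m, n) :=
  map_mx (reval ^~ s) F.

Definition mxconst m n (A : 'M[C]_(m, n)) : 'M[ratfun C]_(m, n) :=
  map_mx rconst A.

Definition HPgap m (T A : 'M[C]_m) : 'M[C]_m :=
  A + A ^t* - (T + A ^t* *m T *m A).

(* Only points where F is defined are considered; that F has no pole in the
   closed right half plane is a consequence, not a requirement. *)
Definition canonicalHP m (T : 'M[C]_m) (F : 'M[ratfun C]_m) : Prop :=
  (forall s, 0 < 'Re s -> ~~ mxpole F s -> possemidefmx (HPgap T (mxreval F s)))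
  /\
  (forall s, 'Re s = 0 -> ~~ mxpole F s -> HPgap T (mxreval F s) = 0).

Definition positive_fun f : Prop :=
  forall s, 0 < 'Re s -> ~~ pole f s /\ 0 <= reval f s + (reval f s)^*.

(* The symmetry holds at every s, with [pole] standing for the value oo. *)
Definition positive_odd_fun f : Prop :=
  positive_fun f /\
  forall s, pole f s = pole f (- s^*) /\
            (~~ pole f s -> reval f s = - (reval f (- s^*))^*).

End RationalFunctions.

Section MatrixFacts.
Variable C : numClosedFieldType.

Lemma sqr_sqrtmx n (A : 'M[C]_n) : A ^t* = A -> sqrtmx A *m sqrtmx A = A.
Proof.
move=> hA; have nA : A \is normalmx by apply/normalmxP; rewrite hA.
have /unitarymxP uU := spectral_unitarymx A.
rewrite /sqrtmx !mulmxA -(mulmxA _ (spectralmx A)) uU mulmx1.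
rewrite -(mulmxA _ (diag_mx _) (diag_mx _)) mulmx_diag.
rewrite [RHS](orthomx_spectralP nA) invmx_unitary ?spectral_unitarymx//.
by congr (_ *m diag_mx _ *m _); apply/rowP => i; rewrite !mxE -expr2 sqrtCK.
Qed.

Let quad_spectral n (A : 'M[C]_n) (d : 'rV[C]_n) (x : 'cV[C]_n) :
  (x ^t* *m ((spectralmx A)^t* *m diag_mx d *m spectralmx A) *m x) 0 0
  = \sum_i d 0 i * `|(spectralmx A *m x) i 0| ^+ 2.
Proof.
set U := spectralmx A.
have -> : x ^t* *m (U^t* *m diag_mx d *m U) *m x
          = (U *m x)^t* *m (diag_mx d *m (U *m x)).
  by rewrite trmx_mul map_mxM !mulmxA.
rewrite mxE; apply: eq_bigr => i _.
by rewrite mul_diag_mx [_^t*]lock !mxE -lock !mxE normCK mulrCA [_^* * _]mulrC.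
Qed.

Let quad_diag n (A : 'M[C]_n) i : A ^t* = A ->
  exists2 x : 'cV[C]_n, x != 0 & (x ^t* *m A *m x) 0 0 = spectral_diag A 0 i.
Proof.
move=> hA; have nA : A \is normalmx by apply/normalmxP; rewrite hA.
have /unitarymxP uU := spectral_unitarymx A.
pose x : 'cV[C]_n := (spectralmx A)^t* *m delta_mx i 0.
have Ux : spectralmx A *m x = delta_mx i 0 by rewrite mulmxA uU mul1mx.
exists x.
  apply/eqP => x0; move: Ux; rewrite x0 mulmx0 => /matrixP/(_ i 0).
  by rewrite !mxE !eqxx => /esym/eqP; rewrite oner_eq0.
have eA : A = (spectralmx A)^t* *m diag_mx (spectral_diag A) *m spectralmx A.
  by rewrite {1}(orthomx_spectralP nA) invmx_unitary ?spectral_unitarymx.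
rewrite [in LHS]eA quad_spectral Ux (bigD1 i)//= big1 ?addr0 => [|j ji].
  by rewrite mxE !eqxx normr1 expr1n mulr1.
by rewrite mxE (negPf ji) normr0 expr0n mulr0.
Qed.

Let sqrtmx_herm n (A : 'M[C]_n) :
  (forall i, 0 <= spectral_diag A 0 i) -> (sqrtmx A)^t* = sqrtmx A.
Proof.
move=> d0; rewrite /sqrtmx !trmx_mul !map_mxM/= trmxCK -mulmxA.
congr (_ *m _); congr (_ *m _); rewrite tr_diag_mx map_diag_mx.
congr diag_mx; apply/rowP => i; rewrite !mxE.
by apply: conj_Creal; rewrite ger0_real// sqrtC_ge0.
Qed.

Lemma sqrtmx_psd n (A : 'M[C]_n) : possemidefmx A -> possemidefmx (sqrtmx A).
Proof.
move=> [hA pA].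
have d0 i : 0 <= spectral_diag A 0 i by have [x _ <-] := quad_diag i hA.
split=> [|x]; first exact: sqrtmx_herm.
rewrite quad_spectral sumr_ge0// => i _.
by rewrite mulr_ge0 ?exprn_ge0// mxE sqrtC_ge0.
Qed.

Lemma sqrtmx_pd n (A : 'M[C]_n) : posdefmx A -> posdefmx (sqrtmx A).
Proof.
move=> [hA pA].
have d0 i : 0 < spectral_diag A 0 i.
  by have [x x0 <-] := quad_diag i hA; apply: pA.
split=> [|x x0]; first by apply: sqrtmx_herm => i; apply: ltW.
have y0 : spectralmx A *m x != 0.
  apply: contra x0 => /eqP y0.
  by rewrite -(mulKmx (spectral_unit A) x) y0 mulmx0.
have [i yi] : exists i, (spectralmx A *m x) i 0 != 0.
  apply/existsP; apply: contraR y0 => /existsPn y0.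
  by apply/eqP/colP => i; rewrite [RHS]mxE; apply/eqP; have := y0 i; rewrite negbK.
rewrite quad_spectral (bigD1 i)//= ltr_pwDl//.
  by rewrite mulr_gt0 ?exprn_gt0 ?normr_gt0// mxE sqrtC_gt0.
by apply: sumr_ge0 => j _; rewrite mulr_ge0 ?exprn_ge0// mxE sqrtC_ge0 ltW.
Qed.

End MatrixFacts.

Section RationalFacts.
Variable C : numClosedFieldType.
Implicit Types (f : ratfun C) (s : C) (p q : {poly C}).
Local Notation tofrac := (@FracField.tofrac {poly C}).

Lemma rden_neq0 f : rden f != 0.
Proof.
rewrite /rden dvdp_div_eq0 ?dvdp_gcdr//; exact: denom_ratioP.
Qed.

Lemma coprimep_rnum_rden f : coprimep (rnum f) (rden f).
Proof.
by rewrite /rnum /rden coprimep_div_gcd// denom_ratioP orbT.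
Qed.

Let pi_frac (x : {ratio {poly C}}) :
  (\pi_({fraction {poly C}})%qT x) * tofrac \d_x = tofrac \n_x.
Proof.
rewrite !piE; apply/eqP; rewrite piE.
rewrite FracField.equivfE /FracField.mulf.
by rewrite !numden_Ratio ?mulf_neq0 ?oner_neq0 ?denom_ratioP// !mulr1 mulrC.
Qed.

Lemma ratfunE f : f = tofrac (rnum f) / tofrac (rden f).
Proof.
set g := gcdp \n_(repr f) \d_(repr f).
have d0 : \d_(repr f) != 0 by exact: denom_ratioP.
have g0 : g != 0 by rewrite gcdp_eq0 negb_and d0 orbT.
have En : \n_(repr f) = rnum f * g by rewrite /rnum divpK// dvdp_gcdl.
have Ed : \d_(repr f) = rden f * g by rewrite /rden divpK// dvdp_gcdr.
have -> : tofrac (rnum f) / tofrac (rden f)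
          = tofrac \n_(repr f) / tofrac \d_(repr f).
  by rewrite En Ed !tofracM -mulf_div divff ?mulr1// tofrac_eq0.
have d0F : tofrac \d_(repr f) != 0 by rewrite tofrac_eq0.
by apply: (mulIf d0F); rewrite mulfVK// -pi_frac reprK.
Qed.

Lemma pole_frac p q s : q.[s] != 0 -> ~~ pole (tofrac p / tofrac q) s.
Proof.
move=> qs; set f := _ / _.
have q0 : q != 0 by apply: contra qs => /eqP->; rewrite horner0.
have cross : rnum f * q = p * rden f.
  have /eqP := ratfunE f; rewrite {1}/f eq_sym eqr_div ?tofrac_eq0 ?rden_neq0//.
  by rewrite -!tofracM tofrac_eq => /eqP.
have dq : rden f %| q.
  rewrite -(Gauss_dvdpr _ (_ : coprimep (rden f) (rnum f))).
    by rewrite cross dvdp_mull.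
  by rewrite coprimep_sym coprimep_rnum_rden.
by apply: contra qs => /(root_dvdp dq).
Qed.

Lemma reval_frac p q s :
  q.[s] != 0 -> reval (tofrac p / tofrac q) s = p.[s] / q.[s].
Proof.
move=> qs; have := pole_frac p qs; rewrite /pole /reval; set f := _ / _ => ds.
have q0 : q != 0 by apply: contra qs => /eqP->; rewrite horner0.
have cross : rnum f * q = p * rden f.
  have /eqP := ratfunE f; rewrite {1}/f eq_sym eqr_div ?tofrac_eq0 ?rden_neq0//.
  by rewrite -!tofracM tofrac_eq => /eqP.
by apply/eqP; rewrite eqr_div// -!hornerM cross.
Qed.

End RationalFacts.

(* Main.v *)
(* Completing the square, S = (T^(1/2) F - T^(-1/2)) (T^-1 - T)^(-1/2) is
   contractive on the open right half plane and unitary on the imaginary axis.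
   F is bounded near any point of the closed right half plane, so it has no
   pole there and S = N / d with N a polynomial matrix, d a product of X - z
   with Re z < 0, and N N~ = d d~ I, where ~ is paraconjugation
   and ^H the conjugate transpose.

   S is peeled off by a double induction on the roots of d and on the rank of
   N(z). With a = - conj z, N(a) kills every v such that v^H lies in the row
   space of N(z), since N(a) N(z)^H = (d d~)(a) I = 0; so N v = (X - a) w, and
   N1 = N + 2 Re(a) w v^H satisfies N1 N1~ = N N~, N1(z) has smaller rank than
   N(z), and N = N1 (I - 2 Re(a) / (s - z) v v^H). When N(z) = 0 the factor
   X - z cancels. Once d = 1, N is paraunitary, hence a constant unitary matrix,
   which the spectral theorem splits into factors with constant psi. *)

From HB Require Import structures.
Require Import Defs.
From mathcomp Require Import all_boot all_order all_algebra fraction.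
From mathcomp Require Import sesquilinear spectral.
From mathcomp Require Import complex reals.
From mathcomp Require Import ring.

Set Implicit Arguments.
Unset Strict Implicit.
Unset Printing Implicit Defensive.

Import Order.TTheory GRing.Theory Num.Theory.
Local Open Scope ring_scope.
Local Open Scope sesquilinear_scope.

HB.instance Definition _ (R : pzSemiRingType) n :=
  Monoid.isLaw.Build 'M[R]_n 1%:M mulmx
    (@mulmxA R n n n n) (@mul1mx R n n) (@mulmx1 R n n).

HB.instance Definition _ (C : numClosedFieldType) :=
  GRing.RMorphism.copy (@rconst C) (@FracField.tofrac {poly C} \o polyC).

(* The polynomial [s |-> conj (p (- conj s))], which agrees with [conj \o p] on
   the imaginary axis. *)
Definition paraconj (C : numClosedFieldType) (p : {poly C}) : {poly C} :=
  map_poly Num.conj p \Po (- 'X).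

HB.instance Definition _ (C : numClosedFieldType) :=
  GRing.RMorphism.copy (@paraconj C)
    (comp_poly (- 'X : {poly C}) \o map_poly (Num.conj : C -> C)).

Section PolynomialMatrices.
Context {C : numClosedFieldType}.
Implicit Types (p q d : {poly C}) (s a z : C).
Local Notation tofrac := (@FracField.tofrac {poly C}).
Local Notation "N ^~" := (map_mx (@paraconj C) N^T) (at level 2, format "N ^~").
Local Notation pconst := (map_mx (@polyC C)).

(** * Paraconjugation of polynomials and of polynomial matrices *)

Lemma horner_paraconj p s : (paraconj p).[s] = (p.[- s^*])^*.
Proof.
rewrite /paraconj horner_comp !hornerE -horner_map /= rmorphN /= conjCK //.
Qed.

Lemma paraconjC a : paraconj a%:P = (a^*)%:P.
Proof. by rewrite /paraconj map_polyC comp_polyC. Qed.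

Lemma paraconjX : paraconj 'X = - 'X :> {poly C}.
Proof. by rewrite /paraconj map_polyX comp_polyX. Qed.

Lemma paraconj_eq0 p : (paraconj p == 0) = (p == 0).
Proof.
rewrite -!size_poly_eq0 /paraconj size_comp_poly2 ?size_map_poly//.
by rewrite size_polyN size_polyX.
Qed.

Lemma coef_paraconj p k : (paraconj p)`_k = (-1) ^+ k * (p`_k)^*.
Proof.
rewrite /paraconj -[- 'X]scaleN1r -[RHS]/((-1) ^+ k * (Num.conj p`_k)) -coef_map.
elim/poly_ind: (map_poly _ p) k => [|q c IH] k; first by rewrite comp_poly0 !coef0 mulr0.
rewrite comp_poly_MXaddC !coefD !coefC -scalerAr coefZ !coefMX IH.
by case: k => [|k]; rewrite /= ?expr0 ?exprS; ring.
Qed.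

Lemma paraadjM m n l (A : 'M[{poly C}]_(m, n)) (B : 'M_(n, l)) :
  (A *m B)^~ = B^~ *m A^~.
Proof. by rewrite trmx_mul map_mxM. Qed.

Lemma pconst_paraadj m n (A : 'M[C]_(m, n)) : (pconst A)^~ = pconst (A^t*).
Proof. by apply/matrixP => i j; rewrite !mxE paraconjC. Qed.

Lemma paraadjZ m n p (A : 'M_(m, n)) : (p *: A)^~ = paraconj p *: A^~.
Proof. by apply/matrixP => i j; rewrite !mxE rmorphM. Qed.

Lemma paraadjD m n (A B : 'M_(m, n)) : (A + B)^~ = A^~ + B^~.
Proof. by rewrite raddfD map_mxD. Qed.

Lemma scalemx_poly_inj m n p : p != 0 ->
  injective (fun A : 'M[{poly C}]_(m, n) => p *: A).
Proof.
move=> p0 A B /matrixP AB; apply/matrixP => i j.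
by have := AB i j; rewrite !mxE => /(mulfI p0).
Qed.

(** * Evaluation of polynomial matrices at a point *)

Definition mxhorner m n (s : C) (N : 'M[{poly C}]_(m, n)) : 'M[C]_(m, n) :=
  map_mx (horner_eval s) N.

Lemma mxhornerM m n l s (A : 'M[{poly C}]_(m, n)) (B : 'M_(n, l)) :
  mxhorner s (A *m B) = mxhorner s A *m mxhorner s B.
Proof. exact: map_mxM. Qed.

Lemma mxhornerD m n s (A B : 'M[{poly C}]_(m, n)) :
  mxhorner s (A + B) = mxhorner s A + mxhorner s B.
Proof. exact: map_mxD. Qed.

Lemma mxhornerB m n s (A B : 'M[{poly C}]_(m, n)) :
  mxhorner s (A - B) = mxhorner s A - mxhorner s B.
Proof. exact: map_mxB. Qed.

Lemma mxhornerZ m n s p (A : 'M[{poly C}]_(m, n)) :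
  mxhorner s (p *: A) = p.[s] *: mxhorner s A.
Proof. exact: map_mxZ. Qed.

Lemma mxhorner_const m n s (A : 'M[C]_(m, n)) : mxhorner s (pconst A) = A.
Proof. by apply/matrixP => i j; rewrite !mxE /= /horner_eval hornerC. Qed.

Lemma mxhorner_paraadj m n s (A : 'M[{poly C}]_(m, n)) :
  mxhorner s A^~ = (mxhorner (- s^* ) A)^t*.
Proof. by apply/matrixP => i j; rewrite !mxE /= /horner_eval horner_paraconj. Qed.

Lemma XsubC_factor m n (N : 'M[{poly C}]_(m, n)) a :
  mxhorner a N = 0 -> exists W, N = ('X - a%:P) *: W.
Proof.
move=> /matrixP Na; exists (map_mx (fun p => p %/ ('X - a%:P)) N).
apply/matrixP => i j; rewrite !mxE mulrC divpK// dvdp_XsubCl.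
by have := Na i j; rewrite !mxE => /eqP.
Qed.

(** * Paraunitary rows of polynomials are constant *)

Lemma coefM_top p q k : (size p <= k.+1)%N -> (size q <= k.+1)%N ->
  (p * q)`_(k + k) = p`_k * q`_k.
Proof.
(* Among the pairs of indices adding up to [k + k], only [(k, k)] has no index above [k]. *)
move=> sp sq; rewrite coefM (bigD1 (inord k)) //= inordK ?ltnS ?leq_addl//.
rewrite addnK big1 ?addr0// => i; rewrite -val_eqE /= inordK ?ltnS ?leq_addl// => ik.
have [ki|ki] := ltnP k i.
  by rewrite [p`_i]nth_default ?mul0r// (leq_trans sp).
rewrite [q`_ _]nth_default ?mulr0// (leq_trans sq)//.
by rewrite ltn_subRL ltn_add2r ltn_neqAle ik.
Qed.

(* The leading coefficients of the [p_j p_j~] all carry the same sign, so they cannot cancel. *)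
Lemma size_paraunitary n (p : 'I_n -> {poly C}) :
  \sum_j p j * paraconj (p j) = 1 -> forall j, (size (p j) <= 1)%N.
Proof.
(* Descent on a common degree bound [k.+1]: the coefficient of degree [k.+1 + k.+1] of the sum
   vanishes, and it is a sign times a sum of squared moduli. *)
move=> E; have step k : (forall j, size (p j) <= k.+2)%N ->
    forall j, (size (p j) <= k.+1)%N.
  move=> sp; have : (\sum_j p j * paraconj (p j))`_(k.+1 + k.+1) = 0.
    by rewrite E coef1.
  rewrite coef_sum (eq_bigr (fun j => (-1) ^+ k.+1 * `|(p j)`_k.+1| ^+ 2)); last first.
    move=> j _; rewrite coefM_top ?coef_paraconj ?normCK; first ring.
    - exact: sp.
    - apply/leq_sizeP => i ki; rewrite coef_paraconj.
      by rewrite nth_default ?rmorph0 ?mulr0// (leq_trans (sp j)).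
  rewrite -mulr_sumr => /eqP; rewrite mulf_eq0 expf_eq0 oppr_eq0 oner_eq0 andbF /=.
  rewrite psumr_eq0 => [/allP pk j|j _]; last by rewrite exprn_ge0.
  have := pk j (mem_index_enum _); rewrite /= expf_eq0 /= normr_eq0 => /eqP pj.
  apply/leq_sizeP => i; rewrite leq_eqVlt => /predU1P[<-//|ki].
  by rewrite nth_default// (leq_trans (sp j)).
suff H k : (forall j, size (p j) <= k.+1)%N -> forall j, (size (p j) <= 1)%N.
  apply: (H (\max_j size (p j))%N) => j.
  by apply: leqW; exact: (leq_bigmax j).
by elim: k => // k IH /step.
Qed.


(** * Scalar positive odd functions and the Blaschke factor *)

Lemma tofrac_frac1 p : tofrac p = tofrac p / tofrac 1.
Proof. by rewrite tofrac1 divr1. Qed.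

Lemma pole_tofrac p s : ~~ pole (tofrac p) s.
Proof. by rewrite tofrac_frac1 pole_frac// hornerE oner_neq0. Qed.

Lemma reval_tofrac p s : reval (tofrac p) s = p.[s].
Proof. by rewrite tofrac_frac1 reval_frac ?hornerE ?oner_neq0// divr1. Qed.

Lemma positive_odd_tofrac p :
  (forall s, 0 < 'Re s -> 0 <= p.[s] + p.[s]^*) ->
  (forall s, p.[s] = - p.[- s^*]^*) -> positive_odd_fun (tofrac p).
Proof.
move=> pos odd; split=> s; first by rewrite pole_tofrac reval_tofrac; split => //; exact: pos.
by rewrite !(negPf (pole_tofrac _ _)) !reval_tofrac.
Qed.

Lemma addC_Re2 s : s + s^* = 2 * 'Re s.
Proof. by rewrite ReE mulrC divfK// pnatr_eq0. Qed.

(* Writing [a] for minus the conjugate of [z], [(psi - 1) / (psi + 1)] is the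
   Blaschke factor [(s - a) / (s - z)]. *)
Definition blaschke_psi (z : C) : ratfun C :=
  tofrac ((- (z + z^* ))^-1 *: (2 *: 'X + (z^* - z)%:P)).

(** [blaschke_psi z] is [(s - i Im z) / |Re z|]: a positive multiple of [s] plus an imaginary
    constant. *)
Lemma positive_odd_blaschke z : 'Re z < 0 -> positive_odd_fun (blaschke_psi z).
Proof.
move=> z0; set c := - (z + z^* ).
have c0 : 0 < c by rewrite /c addC_Re2 oppr_gt0 pmulr_rlt0.
have cC : (c^-1)^* = c^-1 by apply: conj_Creal; rewrite realV gtr0_real.
have E s : (c^-1 *: (2 *: 'X + (z^* - z)%:P)).[s] = c^-1 * (2 * s + (z^* - z)).
  by rewrite !hornerE.
have EC s : (c^-1 * (2 * s + (z^* - z)))^* = c^-1 * (2 * s^* + (z - z^* )).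
  by rewrite rmorphM rmorphD rmorphM rmorphB /= cC conjCK conjC_nat.
apply: positive_odd_tofrac => s => [s0|]; rewrite !E EC.
  rewrite (_ : _ + _ = c^-1 * (2 * (s + s^* ))); last by ring.
  by rewrite addC_Re2 ltW// !mulr_gt0 ?invr_gt0.
by rewrite rmorphN /= conjCK; ring.
Qed.

Lemma ratfun2_neq0 : (2 : ratfun C) != 0.
Proof. by rewrite -(rmorph_nat tofrac 2) tofrac_eq0 -polyC_natr polyC_eq0 pnatr_eq0. Qed.

(** Since [1 + psi = 2 (s - z) / c] with [c = - 2 Re z], the elementary factor is
    [I - c / (s - z) v v^*]. *)
Lemma factor_blaschke z : 'Re z < 0 ->
  2 / (1 + blaschke_psi z) = tofrac (- (z + z^* ))%:P / tofrac ('X - z%:P).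
Proof.
move=> z0; have c0 : - (z + z^* ) != 0.
  by rewrite oppr_eq0 addC_Re2 mulf_neq0 ?pnatr_eq0// lt_eqF.
have -> : 1 + blaschke_psi z = 2 * tofrac ('X - z%:P) / tofrac (- (z + z^* ))%:P.
  have t0 : tofrac (- (z + z^* ))%:P != 0 by rewrite tofrac_eq0 polyC_eq0.
  apply: (mulIf t0); rewrite mulfVK// /blaschke_psi -tofrac1 -tofracD -tofracM.
  rewrite -[2]/(2%:R) -(rmorph_nat tofrac 2) -tofracM; congr tofrac.
  rewrite -!mul_polyC mulrDl mul1r mulrAC -polyCM mulVf// polyC1 mul1r.
  by rewrite polyC_natr rmorphN rmorphD rmorphB /=; ring.
by rewrite invf_div mulrA -mulf_div divff ?mul1r// ratfun2_neq0.
Qed.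

Lemma positive_odd_const a : 'Re a = 0 -> positive_odd_fun (rconst a).
Proof.
move=> a0; have aa : a + a^* = 0 by rewrite addC_Re2 a0 mulr0.
apply: positive_odd_tofrac => s => [_|]; rewrite !hornerE ?aa//.
by apply/eqP; rewrite -subr_eq0 opprK aa.
Qed.

(** * Products of elementary factors *)

Section Products.
Context {m : nat}.

(** An elementary Blaschke-Potapov factor; the pair holds its direction and its scalar function. *)
Definition bp_factor (x : 'cV[C]_m * ratfun C) : 'M[ratfun C]_m :=
  1%:M - (2 / (1 + x.2)) *: mxconst (x.1 *m x.1^t*).

Definition bp_data (l : seq ('cV[C]_m * ratfun C)) : Prop :=
  forall x, x \in l -> x.1^t* *m x.1 = 1%:M /\ positive_odd_fun x.2.

Definition bp_product l := \big[mulmx/1%:M]_(x <- l) bp_factor x.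

Lemma bp_data_rcons l x : bp_data l -> x.1^t* *m x.1 = 1%:M ->
  positive_odd_fun x.2 -> bp_data (rcons l x).
Proof. by move=> gl g1 g2 y; rewrite mem_rcons inE => /predU1P[->//|/gl]. Qed.

Lemma mxconstM k l n (A : 'M[C]_(k, l)) (B : 'M_(l, n)) :
  mxconst (A *m B) = mxconst A *m mxconst B.
Proof. exact: map_mxM. Qed.

Lemma mxconst1 k : mxconst (1%:M : 'M[C]_k) = 1%:M.
Proof. exact: map_mx1. Qed.

Lemma mxconstE k l (A : 'M[C]_(k, l)) : mxconst A = map_mx tofrac (pconst A).
Proof. by apply/matrixP => i j; rewrite !mxE. Qed.

(** [v] is the conjugate transpose of [y] divided by its norm; being a multiple of [y], [v^*] stays
    in any row space containing [y]. *)
Lemma normalize_row (y : 'rV[C]_m) : y != 0 ->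
  exists2 v : 'cV[C]_m, v^t* *m v = 1%:M & exists b, v^t* = b *: y.
Proof.
move=> y0; pose n2 := (y *m y^t* ) 0 0.
have n2E : n2 = \sum_i `|y 0 i| ^+ 2.
  by rewrite /n2 mxE; apply: eq_bigr => i _; rewrite !mxE normCK.
have n2_ge0 : 0 <= n2 by rewrite n2E sumr_ge0// => i _; rewrite exprn_ge0.
have n2_neq0 : n2 != 0.
  apply: contra y0; rewrite n2E psumr_eq0 => [/allP y0|i _]; last by rewrite exprn_ge0.
  apply/eqP/rowP => i; rewrite mxE; apply/eqP.
  by have := y0 i (mem_index_enum _); rewrite /= expf_eq0 /= normr_eq0.
pose b := (sqrtC n2)^-1.
have bb : b^* = b by apply: conj_Creal; rewrite realV ger0_real ?sqrtC_ge0.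
have bE : (b *: y^t* )^t* = b *: y.
  by apply/matrixP => i j; rewrite !mxE rmorphM/= conjCK bb.
exists (b *: y^t* ); last by exists b.
rewrite bE -scalemxAl -scalemxAr scalerA [_ *m _]mx11_scalar -/n2.
by rewrite scale_scalar_mx /b -invfM -expr2 sqrtCK mulVf.
Qed.

(** In an orthonormal eigenbasis [v_i] with eigenvalues [d_i], [U] is the product of the matrices
    [I - (1 - d_i) v_i v_i^*]. *)
Lemma unitary_bp_product (U : 'M[C]_m) : U *m U^t* = 1%:M ->
  exists2 l, bp_data l & mxconst U = bp_product l.
Proof.
move=> UU; have nU : U \is normalmx.
  by apply/normalmxP; rewrite UU (mulmx1C UU).
pose P := spectralmx U; pose d := spectral_diag U.
have PP : P *m P^t* = 1%:M by apply/unitarymxP/spectral_unitarymx.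
have UE : U = P^t* *m diag_mx d *m P.
  by rewrite {1}(orthomx_spectralP nU) invmx_unitary ?spectral_unitarymx.
have dd i : d 0 i * (d 0 i)^* = 1.
  have : diag_mx d *m (diag_mx d)^t* = 1%:M.
    have -> : diag_mx d = P *m U *m P^t*.
      by rewrite UE !mulmxA PP mul1mx -mulmxA PP mulmx1.
    rewrite !trmx_mul !map_mxM trmxCK !mulmxA -(mulmxA _ (P^t* ) P) (mulmx1C PP).
    by rewrite mulmx1 -(mulmxA P) UU mulmx1.
  rewrite tr_diag_mx map_diag_mx mulmx_diag => /matrixP/(_ i i).
  by rewrite !mxE eqxx.
pose v i : 'cV[C]_m := P^t* *m delta_mx i 0.
have vC i : (v i)^t* = delta_mx 0 i *m P.
  by rewrite /v trmx_mul map_mxM trmxCK trmx_delta map_delta_mx.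
have vv i : (v i)^t* *m v i = 1%:M.
  rewrite vC /v mulmxA -(mulmxA _ P) PP mulmx1 mul_delta_mx.
  by apply/matrixP => a b; rewrite !ord1 !mxE.
(* [D s] keeps the eigenvalues indexed by [s] and sets the others to 1; this describes the partial
   products. *)
pose D (s : seq 'I_m) := diag_mx (\row_j if j \in s then d 0 j else 1).
have prodE (s : seq 'I_m) : uniq s ->
    \big[mulmx/1%:M]_(i <- s) (1%:M - (1 - d 0 i) *: (v i *m (v i)^t*)) =
    P^t* *m D s *m P.
  elim: s => [_|i s IHs /= /andP[iNs us]].
    rewrite big_nil /D (_ : \row__ _ = const_mx 1) ?diag_const_mx ?mulmx1 ?(mulmx1C PP)//.
    by apply/rowP => j; rewrite !mxE.
  rewrite big_cons IHs//.
  have -> : 1%:M - (1 - d 0 i) *: (v i *m (v i)^t*) = P^t* *m D [:: i] *m P.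
    rewrite vC /v mulmxA -(mulmxA (P^t* )) mul_delta_mx -(mulmx1C PP).
    rewrite -[P^t* in X in X - _]mulmx1 scalemxAl scalemxAr -mulmxBl -mulmxBr.
    congr (_ *m _ *m _); apply/matrixP => j k; rewrite !mxE inE.
    case: (eqVneq j k) => [<-|jk]; rewrite ?andbb ?mulr1n ?mulr0n.
      by case: eqP => [->|_]; rewrite /= ?mulr1 ?mulr0 ?subr0// opprB addrC subrK.
    by case: (eqVneq j i) jk => [->|_] /= jk; rewrite ?(eq_sym k) ?(negPf jk) mulr0 subr0.
  rewrite !mulmxA -(mulmxA _ P) PP mulmx1 -(mulmxA _ (D [:: i])) /D mulmx_diag.
  congr (_ *m diag_mx _ *m _); apply/rowP => j; rewrite !mxE !inE.
  by case: eqVneq => [->|]; rewrite ?(negPf iNs) ?mulr1 ?mul1r.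
(* The Cayley transform solves [2 / (1 + psi) = 1 - d]; it is imaginary because [|d| = 1]. *)
pose psi i : ratfun C := rconst ((1 + d 0 i) / (1 - d 0 i)).
(* An eigenvalue 1 gives an identity factor and has no finite Cayley transform, so these indices are
   dropped. *)
pose s : seq 'I_m := [seq i <- enum 'I_m | d 0 i != 1].
exists [seq (v i, psi i) | i <- s].
  move=> _ /mapP[i _ ->]; split=> //=; apply: positive_odd_const.
  apply: (mulfI (_ : 2 != 0)); rewrite ?pnatr_eq0// mulr0 -addC_Re2.
  (* For an eigenvalue 1, division by zero makes the constant 0, whose real part is 0. *)
  have [->|d1] := eqVneq (d 0 i) 1; first by rewrite subrr invr0 mulr0 rmorph0 addr0.
  have d0 : d 0 i != 0 by apply: contra_eq_neq (dd i) => ->; rewrite mul0r eq_sym oner_eq0.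
  have dC : (d 0 i)^* = (d 0 i)^-1 by apply: (mulfI d0); rewrite dd mulfV.
  rewrite rmorphM fmorphV rmorphB rmorphD rmorph1 /= dC.
  have d1' : 1 - d 0 i != 0 by rewrite subr_eq0 eq_sym.
  have d1'' : d 0 i - 1 != 0 by rewrite subr_eq0.
  by field; rewrite ?d0 ?d1' ?d1''.
have -> : U = P^t* *m D s *m P.
  rewrite {1}UE; congr (_ *m diag_mx _ *m _); apply/rowP => j; rewrite !mxE.
  by rewrite mem_filter mem_enum andbT; case: eqP.
have us : uniq s by rewrite filter_uniq ?enum_uniq.
rewrite -(prodE _ us) /bp_product big_map.
rewrite (big_morph _ (@mxconstM m m m) (mxconst1 m)).
apply: eq_big_seq => i; rewrite mem_filter => /andP[di _].
rewrite /bp_factor /= /mxconst map_mxB map_mx1 map_mxZ; congr (_ - _ *: _).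
have d1' : 1 - d 0 i != 0 by rewrite subr_eq0 eq_sym.
rewrite -[2]/(2%:R) -(rmorph_nat (@rconst C) 2) -(rmorph1 (@rconst C)) /psi.
rewrite -rmorphD -fmorphV -rmorphM /=; congr rconst.
rewrite (_ : 1 + _ / _ = 2 / (1 - d 0 i)); first by rewrite invf_div mulrCA mulfV ?pnatr_eq0// mulr1.
by field.
Qed.

(** [N] and [d] are kept apart and may share roots, so that peeling a factor changes [N] alone; [d]
    shrinks only when [N(z) = 0]. *)
Lemma paraunitary_bp_product rs (N : 'M[{poly C}]_m) :
  let d := \prod_(z <- rs) ('X - z%:P) in
  all (fun z => 'Re z < 0) rs -> N *m N^~ = (d * paraconj d)%:M ->
  exists2 l, bp_data l & map_mx tofrac N = tofrac d *: bp_product l.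
Proof.
move=> d; rewrite {}/d.
elim: rs N => [|z rs IHrs] N.
  rewrite big_nil rmorph1 mul1r => _ NN.
  have N1 i j : (size (N i j) <= 1)%N.
    apply: (@size_paraunitary m (fun j => N i j)).
    have /matrixP/(_ i i) := NN; rewrite !mxE eqxx mulr1n => <-.
    by apply: eq_bigr => k _; rewrite !mxE.
  pose U := map_mx (fun p : {poly C} => p`_0) N.
  have NU : N = pconst U.
    by apply/matrixP => i j; rewrite !mxE [LHS]size1_polyC.
  have [|l gl lE] := @unitary_bp_product U.
    apply: (map_mx_inj (f:=polyC)).
    rewrite map_mxM -pconst_paraadj -NU map_mx1 NN//.
  by exists l => //; rewrite tofrac1 scale1r -lE NU mxconstE.
rewrite /= => /andP[z0 rs0].
have {IHrs} IHrs N' : N' *m N'^~ = _ -> _ := fun e => IHrs N' rs0 e.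
rewrite big_cons; set d := \prod_(z <- rs) _ in IHrs *.
have [r rk] := ubnP (\rank (mxhorner z N)); elim: r N rk => // r IHr N.
rewrite ltnS => rk NN; have [rk0|rk0] := posnP (\rank (mxhorner z N)).
  have /XsubC_factor[W NW] : mxhorner z N = 0 by apply/eqP; rewrite -mxrank_eq0 rk0.
  rewrite {}NW in NN *; have [|l gl lE] := IHrs W.
    have p0 : ('X - z%:P) * paraconj ('X - z%:P) != 0.
      by rewrite mulf_neq0 ?paraconj_eq0 ?polyXsubC_eq0.
    apply: (scalemx_poly_inj p0) => /=.
    rewrite -scalerA scalemxAr -paraadjZ scalemxAl NN.
    by rewrite scale_scalar_mx; congr scalar_mx; rewrite [in LHS]rmorphM /=; ring.
  exists l => //; rewrite tofracM -scalerA -lE.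
  by apply/matrixP => i j; rewrite !mxE tofracM.
set A := mxhorner z N in rk rk0.
have [x xA0] : exists x : 'rV_m, x *m A != 0.
  have /rowV0Pn[_ /submxP[x ->] xA0] : A != 0 by rewrite -mxrank_eq0 -lt0n.
  by exists x.
have [v vv vA] : exists2 v : 'cV[C]_m, v^t* *m v = 1%:M & (v^t* <= A)%MS.
  have [v vv [b vE]] := normalize_row xA0; exists v => //.
  by rewrite vE scalemx_sub// submxMl.
pose a := - z^*; have aK : - a^* = z by rewrite /a rmorphN /= conjCK opprK.
have aK' : a^* = - z by rewrite -aK opprK.
have Nav : mxhorner a N *m v = 0.
  have [D vD] := submxP vA.
  rewrite -[v]trmxCK vD trmx_mul map_mxM mulmxA.
  have -> : A^t* = mxhorner a N^~ by rewrite mxhorner_paraadj aK.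
  rewrite -mxhornerM NN; apply/matrixP => i j; rewrite !mxE /= /horner_eval.
  (* At [a], the paraconjugate of the whole denominator is the conjugate of its value at [z], which
     is 0. *)
  rewrite big1// => k _; rewrite !mxE /= /horner_eval.
  rewrite hornerMn hornerM horner_paraconj hornerM aK.
  by rewrite !hornerE subrr mul0r rmorph0 mulr0 mul0rn mul0r.
have [w Nv] : exists w, N *m pconst v = ('X - a%:P) *: w.
  by apply: XsubC_factor; rewrite mxhornerM mxhorner_const.
(* [c = 2 Re a] is the constant with [X - a + c = X - z], so that [N1 v = (X - z) w]. *)
pose c := - (z + z^* ).
have vvP : pconst (v^t* ) *m pconst v = 1%:M by rewrite -map_mxM vv map_mx1.
pose N1 := N + c%:P *: (w *m pconst (v^t* )).
have N1v : N1 *m pconst v = ('X - z%:P) *: w.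
  rewrite mulmxDl Nv -scalemxAl -mulmxA vvP mulmx1 -scalerDl.
  congr (_ *: _); rewrite /c /a; rewrite !(rmorphN, rmorphD) /=; ring.
have N1N1 : N1 *m N1^~ = N *m N^~.
  have wN : pconst (v^t* ) *m N^~ = paraconj ('X - a%:P) *: w^~.
    by rewrite -paraadjZ -Nv paraadjM pconst_paraadj.
  rewrite paraadjD paraadjZ paraadjM pconst_paraadj trmxCK.
  have e1 (b : {poly C}) :
    N *m (b *: (pconst v *m w^~)) = (b * ('X - a%:P)) *: (w *m w^~).
    by rewrite -scalemxAr mulmxA Nv -scalemxAl scalerA.
  have e2 : (c%:P *: (w *m pconst (v^t* ))) *m N^~ =
            (c%:P * paraconj ('X - a%:P)) *: (w *m w^~).
    by rewrite -scalemxAl -mulmxA wN -scalemxAr scalerA.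
  have e3 (b : {poly C}) :
    (c%:P *: (w *m pconst (v^t* ))) *m (b *: (pconst v *m w^~)) =
    (c%:P * b) *: (w *m w^~).
    by rewrite -scalemxAl -scalemxAr scalerA mulmxA -(mulmxA w) vvP mulmx1.
  (* [c] is real and [(X - a) + (X - a)~ = - c], so the three coefficients of [w w~] cancel. *)
  have ce : paraconj c%:P * ('X - a%:P) +
      (c%:P * paraconj ('X - a%:P) + c%:P * paraconj c%:P) = 0.
    rewrite rmorphB /= paraconjX !paraconjC aK' /c /a !(rmorphN, rmorphD) /= conjCK.
    ring.
  by rewrite mulmxDl !mulmxDr e1 e2 e3 -addrA -!scalerDl ce scale0r addr0.
(* Adding multiples of [v^*] stays in the row space of [N(z)]. The inclusion is strict:
   [N1(z) v = 0] while [v^* v = 1], so [v^*] is not in the row space of [N1(z)]. *)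
have rkN1 : (\rank (mxhorner z N1) < r)%N.
  apply: leq_trans rk; apply: rank_ltmx; rewrite ltmxE; apply/andP; split.
    rewrite mxhornerD mxhornerZ mxhornerM mxhorner_const addmx_sub//.
    by rewrite scalemx_sub// mulmx_sub.
  apply/negP => /(submx_trans vA)/submxP[D vD].
  have := vv; rewrite vD -mulmxA -[v](mxhorner_const z) -mxhornerM N1v mxhornerZ.
  rewrite !hornerE subrr scale0r mulmx0 => /matrixP/(_ 0 0)/eqP.
  by rewrite !mxE eqxx eq_sym oner_eq0.
have [l gl lE] := IHr _ rkN1 (etrans N1N1 NN).
exists (rcons l (v, blaschke_psi z)).
  by apply: bp_data_rcons => //; apply: positive_odd_blaschke.
rewrite /bp_product big_rcons /= -/(bp_product l) /bp_factor /= factor_blaschke// -/c.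
rewrite scalemxAl -lE mulmxBr mulmx1 -scalemxAr mxconstE -map_mxM.
rewrite (map_mxM polyC) mulmxA N1v -scalemxAl map_mxZ scalerA mulfVK; last first.
  by rewrite tofrac_eq0 polyXsubC_eq0.
by rewrite /N1 map_mxD map_mxZ addrK.
Qed.

End Products.

(** * Boundedness excludes poles *)

Lemma horner_bounded p a :
  exists2 M, 0 <= M & forall t, `|t| <= 1 -> `|p.[a + t]| <= M.
Proof.
elim/poly_ind: p => [|p c [M M0 pM]].
  by exists 0 => // t _; rewrite horner0 normr0.
exists (M * (`|a| + 1) + `|c|) => [|t t1].
  by rewrite addr_ge0 ?mulr_ge0 ?addr_ge0.
rewrite !hornerE (le_trans (ler_normD _ _))// lerD2r normrM ler_pM ?pM//.
by rewrite (le_trans (ler_normD _ _))// lerD2l.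
Qed.

(** The first [size p] values of [f] exceed the degree of [p] in number, so they cannot all be
    roots. *)
Lemma exists_nonroot p (f : nat -> C) : p != 0 -> injective f ->
  exists k, p.[f k] != 0.
Proof.
move=> p0 f_inj; have [/allP fr|] := boolP (all (root p) (map f (iota 0 (size p)))).
  have := @max_poly_roots _ p (map f (iota 0 (size p))) p0.
  rewrite size_map size_iota ltnn map_inj_uniq// iota_uniq => H.
  by have := H (introT allP fr) isT.
by move=> /allPn[_ /mapP[k _ ->]]; exists k.
Qed.

(** The points ['i * k] are infinitely many; this turns identities on the imaginary axis into
    identities of polynomials. *)
Lemma poly_eq_imaginary p q :
  (forall s, 'Re s = 0 -> p.[s] = q.[s]) -> p = q.
Proof.
move=> pq; apply/eqP; rewrite -subr_eq0; apply: contraT => pq0.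
have f_inj : injective (fun k => 'i * k%:R : C).
  by move=> k l /(mulfI (neq0Ci C)) /eqP; rewrite eqr_nat => /eqP.
have [k] := exists_nonroot pq0 f_inj.
rewrite !hornerE pq ?subrr ?eqxx// ReE rmorphM /= conjCi conjC_nat mulNr subrr.
by rewrite mul0r.
Qed.

(* If [a] were a pole, then [t |rnum (a + t)| <= O(t)] along small [t > 0] would
   force the numerator to vanish at [a] as well. *)
Lemma bounded_no_pole (f : ratfun C) q K a : q != 0 -> 0 <= K -> 0 <= 'Re a ->
  (forall s, 0 < 'Re s -> q.[s] != 0 -> `|reval f s| <= K) -> ~~ pole f a.
Proof.
move=> q0 K0 a0 fK; apply/negP => pa.
have na : (rnum f).[a] != 0.
  by apply/negP => na; have := coprimep_root (coprimep_rnum_rden f) na; rewrite (eqP pa) eqxx.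
have /factor_theorem[d dE] := pa.
have /factor_theorem[n nE] : root (rnum f - (rnum f).[a]%:P) a.
  by rewrite /root !hornerE subrr.
have [M M0 dM] := horner_bounded d a; have [N N0 nN] := horner_bounded n a.
(* [B] makes [t <= |c| / B] imply both [t <= 1] and [t * (N + K * M) < |c|]. *)
set c := (rnum f).[a] in na nE; set B := `|c| + (N + K * M) + 1.
have B0 : 0 < B by rewrite ltr_wpDl// ?addr_ge0 ?mulr_ge0.
have c0 : 0 < `|c| by rewrite normr_gt0.
have t_inj : injective (fun k : nat => a + `|c| / B / k.+1%:R).
  move=> k l /addrI /(mulfI (lt0r_neq0 (divr_gt0 c0 B0))) /invr_inj /eqP.
  by rewrite eqr_nat => /eqP[].
have [|k] := exists_nonroot _ t_inj (p := q * rden f).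
  by rewrite mulf_neq0 ?rden_neq0.
set t := _ / k.+1%:R; rewrite hornerM mulf_eq0 negb_or => /andP[qt dt].
have t0 : 0 < t by rewrite !divr_gt0 ?ltr0n.
have tcB : t <= `|c| / B.
  by rewrite ler_pdivrMr ?ltr0n// ler_peMr ?ler1n// divr_ge0// ltW.
have Bc : B - `|c| = N + K * M + 1 by rewrite /B; ring.
clearbody t; have t1 : `|t| <= 1.
  rewrite gtr0_norm// (le_trans tcB)// ler_pdivrMr// mul1r -subr_ge0 Bc.
  by rewrite !addr_ge0 ?mulr_ge0.
have st : 0 < 'Re (a + t).
  by rewrite raddfD /= ltr_wpDl// (Creal_ReP _ _) ?gtr0_real.
have := fK _ st qt; rewrite /reval normf_div ler_pdivrMr ?normr_gt0//.
have -> : (rden f).[a + t] = d.[a + t] * t by rewrite dE !hornerE [a + t - a]addrAC subrr add0r.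
have nt : (rnum f).[a + t] = n.[a + t] * t + c.
  by rewrite -[rnum f](subrK c%:P) nE !hornerE [a + t - a]addrAC subrr add0r.
rewrite nt => le1.
(* With numerator [n t + c] and denominator [d t], the bound [K] gives
   [|c| <= |n t + c| + |n t| <= K M t + N t]. *)
have le2 : `|c| <= t * (N + K * M).
  have := lerB_dist (n.[a + t] * t + c) (n.[a + t] * t).
  have := ler_normB (n.[a + t] * t + c) (n.[a + t] * t).
  rewrite [_ * t + c in X in X <= _]addrC addrK => /le_trans + _; apply.
  rewrite mulrDr [X in _ <= X]addrC lerD ?(le_trans le1)//.
    rewrite [t * _]mulrC normrM (gtr0_norm t0) mulrA ler_wpM2r ?(ltW t0)//.
    by rewrite ler_wpM2l ?dM.
  by rewrite normrM (gtr0_norm t0) mulrC ler_wpM2l ?nN ?(ltW t0).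
have : t * (N + K * M) < `|c|.
  apply: (@le_lt_trans _ _ (`|c| / B * (N + K * M))).
    by rewrite ler_wpM2r ?addr_ge0 ?mulr_ge0.
  rewrite mulrAC ltr_pdivrMr// ltr_pM2l// -subr_gt0.
  by rewrite (_ : B - _ = `|c| + 1) ?addr_gt0// /B; ring.
by move=> /lt_le_trans/(_ le2); rewrite ltxx.
Qed.

(** * Hermitian and positive definite matrices *)

Lemma adjmxB n l (A B : 'M[C]_(n, l)) : (A - B)^t* = A^t* - B^t*.
Proof. by apply/matrixP => i j; rewrite !mxE rmorphB. Qed.

Lemma quad_delta n (A : 'M[C]_n) j :
  ((@delta_mx C n 1 j 0)^t* *m A *m @delta_mx C n 1 j 0) 0 0 = A j j.
Proof. by rewrite trmx_delta map_delta_mx -rowE -colE !mxE. Qed.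

Lemma invmx_herm n (A : 'M[C]_n) : A^t* = A -> (invmx A)^t* = invmx A.
Proof. by move=> hA; rewrite trmx_inv map_invmx hA. Qed.

Lemma posdefmx_unit n (A : 'M[C]_n) : posdefmx A -> A \in unitmx.
Proof.
move=> [hA pA]; rewrite -row_free_unit -kermx_eq0; apply: contraT => /rowV0Pn[u].
move=> /sub_kermxP uA u0; have := pA (u^t* ).
rewrite trmxCK uA mul0mx mxE ltxx; apply.
by apply: contra u0 => /eqP u0; rewrite -[u]trmxCK u0 trmx0 map_mx0.
Qed.

(** * From [F] to a paraunitary polynomial matrix *)

Section Potapov.
Context {m : nat} {T : 'M[C]_m} (T_pd : posdefmx T) (T_lt1 : posdefmx (1%:M - T)).
Let H := sqrtmx T.
Let Hi := invmx H.
Let D := invmx T - T.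
Let E := sqrtmx D.

Let HH : H *m H = T. Proof. exact: sqr_sqrtmx (proj1 T_pd). Qed.
Let H_herm : H^t* = H. Proof. exact: (proj1 (sqrtmx_pd T_pd)). Qed.
Let H_unit : H \in unitmx. Proof. exact: posdefmx_unit (sqrtmx_pd T_pd). Qed.
Let Hi_herm : Hi^t* = Hi. Proof. exact: invmx_herm. Qed.

Let HiHi : Hi *m Hi = invmx T.
Proof.
apply: (can_inj (mulKmx (posdefmx_unit T_pd))).
by rewrite mulmxV ?posdefmx_unit// -HH mulmxA mulmxK// mulmxV.
Qed.

(** [T^-1 - T = T^(-1/2) (I - T) T^(-1/2) + (I - T)], a sum of two positive definite matrices. *)
Lemma posdefmx_inv_sub : posdefmx D.
Proof.
have DE : D = Hi *m (1%:M - T) *m Hi + (1%:M - T).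
  have HiT : Hi *m T = H by rewrite -HH mulKmx.
  by rewrite mulmxBr mulmx1 mulmxBl HiHi HiT mulmxV// addrA subrK.
split=> [|x x0]; first by rewrite /D adjmxB invmx_herm ?(proj1 T_pd).
rewrite DE mulmxDr mulmxDl mxE addr_gt0 ?(proj2 T_lt1)//.
have -> : x^t* *m (Hi *m (1%:M - T) *m Hi) *m x
        = (Hi *m x)^t* *m (1%:M - T) *m (Hi *m x).
  by rewrite trmx_mul map_mxM Hi_herm !mulmxA.
apply: (proj2 T_lt1); apply: contra x0 => /eqP Hx.
by rewrite -(mulKVmx H_unit x) -/Hi Hx mulmx0.
Qed.

Let EE : E *m E = D. Proof. exact: sqr_sqrtmx (proj1 posdefmx_inv_sub). Qed.
Let E_herm : E^t* = E. Proof. exact: (proj1 (sqrtmx_pd posdefmx_inv_sub)). Qed.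
Let E_unit : E \in unitmx. Proof. exact: posdefmx_unit (sqrtmx_pd posdefmx_inv_sub). Qed.

(* Completing the square: the gap measures how far [T^(1/2) A - T^(-1/2)],
   renormalised by [(T^-1 - T)^(-1/2)], is from being a contraction. *)
Lemma HPgapE (A : 'M[C]_m) :
  HPgap T A = D - (H *m A - Hi)^t* *m (H *m A - Hi).
Proof.
rewrite adjmxB trmx_mul map_mxM H_herm Hi_herm.
have e1 : A^t* *m H *m (H *m A) = A^t* *m T *m A.
  by rewrite mulmxA -(mulmxA (A^t* )) HH.
rewrite mulmxBl !mulmxBr e1 (mulmxK H_unit) (mulKmx H_unit) HiHi /HPgap /D.
set P := A^t* *m T *m A; set A' := A^t*.
apply/matrixP => i j; rewrite !mxE; ring.
Qed.

Let HF_factor (A : 'M[C]_m) : A = Hi *m (H *m A - Hi) + invmx T.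
Proof. by rewrite mulmxBr mulKmx// HiHi subrK. Qed.

(** Tested on basis vectors, the gap bounds the squared norm of column [j] of [T^(1/2) A - T^(-1/2)]
    by [D j j]. The bound depends on [T] only, hence is uniform over the values of [F]. *)
Lemma HPgap_bound : exists K : 'I_m -> 'I_m -> C,
  (forall i j, 0 <= K i j) /\
  forall A, possemidefmx (HPgap T A) -> forall i j, `|A i j| <= K i j.
Proof.
have D0 j : 0 <= D j j.
  rewrite -quad_delta ltW// (proj2 posdefmx_inv_sub)//.
  by apply/eqP => /matrixP/(_ j 0)/eqP; rewrite !mxE !eqxx oner_eq0.
(* [1 + D j j] bounds the square root of [D j j]. *)
exists (fun i j => \sum_k `|Hi i k| * (1 + D j j) + `|invmx T i j|).
split=> [i j|A [_ gapA] i j].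
  by rewrite addr_ge0// sumr_ge0// => k _; rewrite mulr_ge0// addr_ge0.
rewrite {1}[A]HF_factor; set G := H *m A - Hi.
have Gj : \sum_k `|G k j| ^+ 2 <= D j j.
  have := gapA (delta_mx j 0); rewrite HPgapE -/G quad_delta.
  rewrite mxE [X in _ + X]mxE subr_ge0 [X in X <= _]mxE.
  by congr (_ <= _); apply: eq_bigr => k _; rewrite !mxE normCK mulrC.
rewrite mxE (le_trans (ler_normD _ _))// lerD2r mxE (le_trans (ler_norm_sum _ _ _))//.
apply: ler_sum => k _; rewrite normrM ler_wpM2l//.
have Gkj : `|G k j| ^+ 2 <= D j j.
  apply: le_trans Gj; rewrite (bigD1 k)//= lerDl sumr_ge0// => l _.
  by rewrite exprn_ge0.
have [G1|G1] := real_leP (normr_real (G k j)) (real1 _).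
  by rewrite (le_trans G1)// lerDl.
by rewrite (le_trans _ (le_trans Gkj _))// ?lerDr// ler_eXnr// ltW.
Qed.

Lemma ratfun_common_den (F : 'M[ratfun C]_m) (d : {poly C}) :
  (forall i j, rden (F i j) %| d) ->
  exists N : 'M[{poly C}]_m, forall i j,
    tofrac d * F i j = tofrac (N i j).
Proof.
move=> dF; exists (\matrix_(i, j) (rnum (F i j) * (d %/ rden (F i j)))) => i j.
rewrite mxE {1}[F i j]ratfunE -{1}(divpK (dF i j)) !tofracM -mulrA.
by rewrite [tofrac (rden _) * _]mulrC divfK ?tofrac_eq0 ?rden_neq0// mulrC.
Qed.

(** A root of the product of all reduced denominators is a pole of some entry; [HPgap_bound] and
    [bounded_no_pole] exclude it from the closed right half plane. *)
Lemma canonicalHP_den (F : 'M[ratfun C]_m) : canonicalHP T F ->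
  exists2 rs : seq C, all (fun z => 'Re z < 0) rs &
    forall i j, rden (F i j) %| \prod_(z <- rs) ('X - z%:P).
Proof.
move=> [Fpos _]; pose q := \prod_i \prod_j rden (F i j).
have q0 : q != 0.
  by apply/prodf_neq0 => i _; apply/prodf_neq0 => j _; exact: rden_neq0.
have dq i j : rden (F i j) %| q.
  by rewrite /q (bigD1 i)//= dvdp_mulr// (bigD1 j)//= dvdp_mulr.
have nopole s : q.[s] != 0 -> ~~ mxpole F s.
  move=> qs; apply/existsPn => i; apply/existsPn => j.
  by apply: contra qs; exact: root_dvdp.
have [rs qE] := closed_field_poly_normal q.
exists rs; last first.
  move=> i j; rewrite -(@dvdpZr _ (lead_coef q)) ?lead_coef_eq0// -qE//.
apply/allP => z zrs; rewrite real_ltNge ?Creal_Re ?real0//; apply/negP => z0.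
have /rootP : root q z by rewrite qE rootZ ?lead_coef_eq0// root_prod_XsubC.
have [K [K0 FK]] := HPgap_bound.
rewrite /q horner_prod => /eqP/prodf_eq0[i _]; rewrite horner_prod => /prodf_eq0[j _].
apply/negP; apply: (bounded_no_pole q0 (K0 i j) z0) => s s0 qs.
by have := FK _ (Fpos s s0 (nopole _ qs)) i j; rewrite mxE.
Qed.

Lemma canonicalHP_factorization (F : 'M[ratfun C]_m) : canonicalHP T F ->
  exists2 l, bp_data l & F = mxconst Hi *m bp_product l *m mxconst E + mxconst (invmx T).
Proof.
move=> HF; have [rs rs0 rsF] := canonicalHP_den HF; set d := \prod_(z <- rs) _ in rsF.
have [N0 N0E] := ratfun_common_den rsF.
have d0 s : 'Re s = 0 -> d.[s] != 0.
  move=> s0; apply: contraL rs0 => ds; apply/allPn; exists s; rewrite ?s0 ?ltxx//.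
  by rewrite -root_prod_XsubC.
have td0 : tofrac d != 0 by rewrite tofrac_eq0; apply: contraTneq isT => dE; have := d0 0; rewrite raddf0 dE horner0 eqxx => /(_ erefl).
have F0 s : 'Re s = 0 -> ~~ mxpole F s /\ mxreval F s = (d.[s])^-1 *: mxhorner s N0.
  move=> s0.
  have FE i j : F i j = tofrac (N0 i j) / tofrac d by rewrite -N0E mulrAC mulfV ?mul1r.
  split.
    apply/existsPn => i; apply/existsPn => j; rewrite FE.
    by apply: pole_frac; exact: d0.
  by apply/matrixP => i j; rewrite !mxE FE reval_frac ?d0// mulrC.
pose N := (pconst H *m N0 - d *: pconst Hi) *m pconst (invmx E).
have NN : N *m N^~ = (d * paraconj d)%:M.
  apply/matrixP => i j; apply: poly_eq_imaginary => s s0.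
  (* On the axis [- s^* = s], so paraconjugation is pointwise conjugation there. *)
  have sE : - s^* = s.
    by apply/eqP; rewrite -subr_eq0 -opprD oppr_eq0 addrC addC_Re2 s0 mulr0.
  suff : mxhorner s (N *m N^~) = mxhorner s (d * paraconj d)%:M.
    by move=> /matrixP/(_ i j); rewrite [LHS]mxE [RHS]mxE.
  have [nF FE] := F0 s s0; have := (proj2 HF) s s0 nF; rewrite HPgapE.
  set G := H *m _ - _ => /subr0_eq/esym GG.
  have NsE : mxhorner s N = d.[s] *: (G *m invmx E).
    rewrite mxhornerM mxhornerB mxhornerZ mxhornerM !mxhorner_const /G FE.
    by rewrite -scalemxAr [RHS]scalemxAl scalerBr scalerA mulfV ?d0// scale1r.
  (* The vanishing gap gives [S^* S = I]; for square matrices [mulmx1C] turns this into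
     [S S^* = I]. *)
  have XX : (G *m invmx E) *m (G *m invmx E)^t* = 1%:M.
    apply: mulmx1C; rewrite trmx_mul map_mxM invmx_herm// -mulmxA (mulmxA _ G) GG.
    by rewrite -EE mulmxK// mulVmx.
  rewrite mxhornerM mxhorner_paraadj sE NsE.
  rewrite linearZ /= map_mxZ -scalemxAl -scalemxAr XX scalerA scale_scalar_mx mulr1.
  by rewrite /mxhorner map_scalar_mx /= /horner_eval hornerM horner_paraconj sE.
have [l gl lE] := paraunitary_bp_product rs0 NN.
exists l => //; have NE : N *m pconst E = pconst H *m N0 - d *: pconst Hi.
  by rewrite -mulmxA -map_mxM mulVmx// map_mx1 mulmx1.
have N0F : map_mx tofrac N0 = tofrac d *: F.
  by apply/matrixP => i j; rewrite !mxE N0E.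
have SE : bp_product l *m mxconst E = mxconst H *m F - mxconst Hi.
  have := congr1 (map_mx tofrac) NE.
  rewrite map_mxM lE map_mxB map_mxZ (map_mxM _ (pconst H)) N0F -!mxconstE.
  rewrite -scalemxAl -scalemxAr -scalerBr => /(congr1 (GRing.scale (tofrac d)^-1)).
  by rewrite !scalerA mulVf// !scale1r.
rewrite -mulmxA SE mulmxBr mulmxA -!mxconstM mulVmx// HiHi.
by rewrite mxconst1 mul1mx subrK.
Qed.

End Potapov.
End PolynomialMatrices.

Theorem proposition4p6 (R : realType) (m : nat) (T : 'M[R[i]]_m)
    (F : 'M[ratfun R[i]]_m) :
  posdefmx T -> posdefmx (1%:M - T) -> canonicalHP T F ->
  exists (k : nat) (v : 'I_k -> 'cV[R[i]]_m) (psi : 'I_k -> ratfun R[i]),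
    [/\ forall j, (v j)^t* *m v j = 1%:M,
        forall j, positive_odd_fun (psi j)
      & F = mxconst (invmx (sqrtmx T))
            *m (\big[mulmx/1%:M]_(j < k)
                  (1%:M - (2 / (1 + psi j)) *: mxconst (v j *m (v j)^t*)))
            *m mxconst (sqrtmx (invmx T - T))
            + mxconst (invmx T)].
Proof.
move=> T_pd T_lt1 HF.
have [l gl ->] := canonicalHP_factorization T_pd T_lt1 HF.
pose x := tnth (in_tuple l); have gx j : _ := gl (x j) (mem_tnth j (in_tuple l)).
exists (size l), (fun j => (x j).1), (fun j => (x j).2).
split=> [j|j|]; [exact: (proj1 (gx j))|exact: (proj2 (gx j))|].
by rewrite /bp_product big_tnth.
Qed.
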